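(* Let $m>1$, and let $M$ be a closed convex subset with nonempty interior of $\mathbb{R}^{m+1}=\mathbb{R}^m\times\mathbb{R}$. Let $K=\{(x,x^{m+1})\in\mathbb{R}^m\times\mathbb{R}:\ \|x\|\le x^{m+1}\}$ be the Lorentz cone. Consider the following assertions: (i) $M$ is invariant with respect to the operations $\sqcap$ and $\sqcup$ defined by $K$; (ii) $M$ is an isotone projection set (with respect to $\le_K$); (iii) $M=C\times\mathbb{R}$, where $C$ is a closed convex set with nonempty interior in $\mathbb{R}^m$. Then (iii) $\Leftrightarrow$ (i) and (i) $\Rightarrow$ (ii).
   Context: Euclidean spaces carry the standard scalar product and norm. The Lorentz cone $K$ is self-dual. The order induced by $K$ is $x\le_K y\Leftrightarrow y-x\in K$. For a nonempty closed convex set $D$, $P_D x$ denotes the unique nearest point of $D$ to $x$; $D$ is an isotone projection set if $x\le_K y$ implies $P_Dx\le_K P_Dy$. The operations defined by $K$ are $x\sqcap y=P_{x-K}\,y$ and $x\sqcup y=P_{x+K}\,y$. A set $M$ is invariant with respect to $\sqcap$ and $\sqcup$ if $x,y\in M$ implies $x\sqcap y\in M$ and $x\sqcup y\in M$. *)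

(* Defs.v *)
From HB Require Import structures.
From mathcomp Require Import all_boot all_order all_algebra.
From mathcomp Require Import all_classical all_reals all_analysis.

Set Implicit Arguments.
Unset Strict Implicit.
Unset Printing Implicit Defensive.

Import Order.TTheory GRing.Theory Num.Theory.
Import numFieldNormedType.Exports.

Local Open Scope classical_set_scope.
Local Open Scope ring_scope.

(* The norm `|x| that MathComp-Analysis puts on 'rV[R]_n is the sup norm, so
   the Euclidean one is defined here.  Both induce the same topology, so
   [closed] and [interior] keep their usual meaning. *)
Definition dotv (R : realType) (n : nat) (x y : 'rV[R]_n) : R :=
  (x *m y^T) 0 0.

Definition enorm (R : realType) (n : nat) (x : 'rV[R]_n) : R :=
  Num.sqrt (dotv x x).

Definition nearest_points (R : realType) (n : nat) (D : set 'rV[R]_n)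
    (x : 'rV[R]_n) : set 'rV[R]_n :=
  [set p | D p /\ forall q, D q -> enorm (x - p) <= enorm (x - q)].

(* For D nonempty, closed and convex, [nearest_points D x] is a singleton and
   [proj D x] is its element; for other D the value may be arbitrary. *)
Definition proj (R : realType) (n : nat) (D : set 'rV[R]_n)
    (x : 'rV[R]_n) : 'rV[R]_n :=
  get (nearest_points D x).

Definition cone_le (R : realType) (n : nat) (K : set 'rV[R]_n)
    (x y : 'rV[R]_n) : Prop := K (y - x).

Definition isotone_projection_set (R : realType) (n : nat)
    (K D : set 'rV[R]_n) : Prop :=
  forall x y, cone_le K x y -> cone_le K (proj D x) (proj D y).

Definition cone_meet (R : realType) (n : nat) (K : set 'rV[R]_n)
    (x y : 'rV[R]_n) : 'rV[R]_n :=
  proj [set x - k | k in K] y.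

Definition cone_join (R : realType) (n : nat) (K : set 'rV[R]_n)
    (x y : 'rV[R]_n) : 'rV[R]_n :=
  proj [set x + k | k in K] y.

Definition cone_invariant (R : realType) (n : nat) (K M : set 'rV[R]_n) : Prop :=
  forall x y, M x -> M y -> M (cone_meet K x y) /\ M (cone_join K x y).

(* R^(m+1) = R^m x R is 'rV[R]_(m + 1): the point (x, t) is
   [row_mx x (const_mx t)], with components [lsubmx z] and [rsubmx z 0 0]. *)
Definition lorentz_cone (R : realType) (m : nat) : set 'rV[R]_(m + 1) :=
  [set z | enorm (lsubmx z) <= rsubmx z 0 0].

Definition cylinder (R : realType) (m : nat) (C : set 'rV[R]_m) :
    set 'rV[R]_(m + 1) :=
  [set z | C (lsubmx z)].

(* Main.v *)
(** If an invariant closed convex set M contains a horizontal disc of radius r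
    about c, then by induction on k it contains the ellipsoid
    t^2 <= k (r^2 - |q|^2) about c: the join of two points at equal height is
    their midpoint raised by half their distance, and m > 1 leaves room to
    choose these two points orthogonally to q.  Hence M contains the vertical
    line through c, and a closed convex set is invariant under translation along
    any line it contains.  Conversely, the projection onto the Lorentz cone
    multiplies the horizontal component by a factor in [0, 1], so that meets and
    joins of x and y have their horizontal component between those of x and y.
    Finally the projection onto a cylinder keeps the vertical component, and it
    is nonexpansive, which makes it isotone. *)
Require Import Defs.
From mathcomp Require Import all_boot all_order all_algebra.
From mathcomp Require Import all_classical all_reals all_analysis.
From mathcomp Require Import ring lra.
Import Order.TTheory GRing.Theory Num.Theory.
Import numFieldNormedType.Exports.
Local Open Scope classical_set_scope.
Local Open Scope ring_scope.

Set Implicit Arguments.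
Unset Strict Implicit.
Unset Printing Implicit Defensive.

Local Notation proj := Defs.proj.

(** * Euclidean geometry and projection onto closed convex sets *)

Section Euclidean.
Variables (R : realType) (n : nat).
Implicit Types (x y z p q : 'rV[R]_n) (a : R) (D : set 'rV[R]_n).

Lemma dotvE x y : dotv x y = \sum_i x 0 i * y 0 i.
Proof. by rewrite /dotv mxE; apply: eq_bigr => i _; rewrite mxE. Qed.

Lemma dotvC x y : dotv x y = dotv y x.
Proof. by rewrite !dotvE; apply: eq_bigr => i _; rewrite mulrC. Qed.

Lemma dotvDl x y z : dotv (x + y) z = dotv x z + dotv y z.
Proof. by rewrite /dotv mulmxDl mxE. Qed.

Lemma dotvZl a x y : dotv (a *: x) y = a * dotv x y.
Proof. by rewrite /dotv -scalemxAl mxE. Qed.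

Lemma dotvNl x y : dotv (- x) y = - dotv x y.
Proof. by rewrite -scaleN1r dotvZl mulN1r. Qed.

Lemma dotvDr x y z : dotv z (x + y) = dotv z x + dotv z y.
Proof. by rewrite dotvC dotvDl !(dotvC z). Qed.

Lemma dotvZr a x y : dotv y (a *: x) = a * dotv y x.
Proof. by rewrite dotvC dotvZl dotvC. Qed.

Lemma dotvNr x y : dotv y (- x) = - dotv y x.
Proof. by rewrite dotvC dotvNl dotvC. Qed.

Definition dotv_lin := (dotvDl, dotvDr, dotvNl, dotvNr, dotvZl, dotvZr).

Lemma dotv_ge0 x : 0 <= dotv x x.
Proof. by rewrite dotvE sumr_ge0// => i _; rewrite -expr2 sqr_ge0. Qed.

Lemma dotv0_eq0 x : dotv x x <= 0 -> x = 0.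
Proof.
move=> x0; have {}x0 : dotv x x = 0 by apply/eqP; rewrite eq_le x0 dotv_ge0.
apply/rowP => i; rewrite mxE; apply/eqP; rewrite -sqrf_eq0 expr2; apply/eqP.
move: x0; rewrite dotvE => /psumr_eq0P; apply=> // j _.
by rewrite -expr2 sqr_ge0.
Qed.

Lemma sqr_coord_le x i : x 0 i ^+ 2 <= dotv x x.
Proof.
rewrite dotvE (bigD1 i)//= -expr2 lerDl sumr_ge0// => j _.
by rewrite -expr2 sqr_ge0.
Qed.

Lemma enorm_ge0 x : 0 <= enorm x. Proof. exact: sqrtr_ge0. Qed.

Lemma enorm_sqr x : enorm x ^+ 2 = dotv x x.
Proof. by rewrite sqr_sqrtr// dotv_ge0. Qed.

Lemma ler_enorm x y : (enorm x <= enorm y) = (dotv x x <= dotv y y).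
Proof. by rewrite /enorm ler_sqrt// dotv_ge0. Qed.

Lemma norm_le_enorm x : `|x| <= enorm x.
Proof.
rewrite [leLHS]/Num.Def.normr/= mx_normrE bigmax_le ?enorm_ge0//= => -[i j] _ /=.
by rewrite (ord1 i) -sqrtr_sqr /enorm ler_sqrt ?dotv_ge0// sqr_coord_le.
Qed.

Lemma CauchySchwarz_enorm x y : dotv x y <= enorm x * enorm y.
Proof.
have [x0|x0] := eqVneq (enorm x) 0.
  suff -> : x = 0 by rewrite -(scale0r x) dotvZl mul0r mulr_ge0// enorm_ge0.
  by apply: dotv0_eq0; rewrite -enorm_sqr x0 expr0n.
have [y0|y0] := eqVneq (enorm y) 0.
  suff -> : y = 0 by rewrite -(scale0r x) dotvZr mul0r mulr_ge0// enorm_ge0.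
  by apply: dotv0_eq0; rewrite -enorm_sqr y0 expr0n.
have xy : 0 < enorm x * enorm y by rewrite mulr_gt0// lt0r ?x0 ?y0 enorm_ge0.
have := dotv_ge0 (enorm y *: x - enorm x *: y).
rewrite !dotv_lin (dotvC y x) -!enorm_sqr => h.
rewrite -(ler_pM2l xy); nra.
Qed.

(** Since |x - q|^2 = |x - p|^2 - 2 <x - p, q - p> + |q - p|^2, the inequality makes p nearest, and
    any other nearest point q has |q - p| = 0. Explicit projections are computed this way. *)
Lemma proj_eq D x p :
  D p -> (forall q, D q -> dotv (x - p) (q - p) <= 0) -> proj D x = p.
Proof.
move=> Dp vip.
have nearest_p : nearest_points D x p.
  split=> // q /vip; rewrite ler_enorm -(subrKA p) => h.
  have := dotv_ge0 (q - p).
  move: h; rewrite !dotv_lin !(dotvC q) !(dotvC p x); lra.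
rewrite /proj; case: (@getPex _ (nearest_points D x)); first by exists p.
set q := get _ => Dq /(_ _ Dp); rewrite ler_enorm => h.
apply/eqP; rewrite -subr_eq0; apply/eqP/dotv0_eq0.
move: h (vip _ Dq); rewrite !dotv_lin !(dotvC q) !(dotvC p x); lra.
Qed.

Lemma continuous_enormB x : continuous (fun z : 'rV[R]_n => enorm (x - z)).
Proof.
move=> z; apply: (@cvg_comp _ _ _ (fun w : 'rV[R]_n => dotv (x - w) (x - w))
  Num.sqrt _ (nbhs (dotv (x - z) (x - z)))); last exact: sqrt_continuous.
rewrite dotvE; under eq_cvg do rewrite dotvE.
have cvg_coord i : (x - w) 0 i @[w --> z] --> (x - z) 0 i.
  under eq_cvg do rewrite !mxE; rewrite !mxE.
  apply: (@cvgB R R _ (nbhs z) _ (fun=> x 0 i) (fun w : 'rV[R]_n => w 0 i)).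
    exact: cvg_cst.
  exact: coord_continuous.
apply: (@cvg_big R 'I_n +%R 0 predT add_continuous _ (nbhs z)) => i _.
exact: (cvgM (cvg_coord i) (cvg_coord i)).
Qed.

Lemma proj_nearest D x : closed D -> D !=set0 -> nearest_points D x (proj D x).
Proof.
move=> clD [d Dd]; apply: getPex.
(* Points farther from x than d cannot matter, so the minimum is sought in a compact set. *)
pose A := D `&` [set z | enorm (x - z) <= enorm (x - d)].
have cA : compact A.
  apply: bounded_closed_compact; last first.
    apply: closedI => //.
    apply: (@preimage_closed _ _ (fun z => enorm (x - z)) [set r | r <= _]);
      last exact: closed_le.
    by move=> z _; exact: continuous_enormB.
  exists (`|x| + enorm (x - d)); split; first exact: num_real.
  move=> r ltr z [_ /= zd].
  rewrite -(subKr x z) (le_trans (ler_normB _ _))// (le_trans _ (ltW ltr))//.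
  by rewrite lerD2l (le_trans (norm_le_enorm _)).
have [||c] := @EVT_min_rV R n (fun z => enorm (x - z)) A _ cA.
- by exists d; split => /=.
- by apply: continuous_subspaceT; exact: continuous_enormB.
rewrite inE => -[Dc cd] minc; exists c; split => // q Dq.
have [qd|/ltW dq] := leP (enorm (x - q)) (enorm (x - d)); last exact: le_trans dq.
by apply: minc; rewrite inE.
Qed.

Lemma convex_setP D x y a :
  convex_set D -> D x -> D y -> 0 <= a -> a <= 1 -> D (x + a *: (y - x)).
Proof.
move=> cD Dx Dy a0 a1.
have := cD y x (Itv01 a0 a1); rewrite !inE => /(_ Dy Dx).
congr D; rewrite [LHS]/conv /= scalerBl scale1r scalerBr.
by rewrite addrC addrAC addrA.
Qed.

Lemma proj_variational D x q :
  closed D -> convex_set D -> D q ->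
  dotv (x - proj D x) (q - proj D x) <= 0.
Proof.
move=> clD cD Dq.
have [Dp minp] : nearest_points D x (proj D x).
  by apply: proj_nearest => //; exists q.
move: (proj D x) Dp minp => p Dp minp.
set d := dotv (x - p) (q - p); rewrite leNgt; apply/negP => d0.
set N := dotv (q - p) (q - p).
have N0 : 0 <= N by exact: dotv_ge0.
have dN : 0 < d + N by rewrite ltr_wpDr.
(* Moving from p towards q by this e comes strictly closer to x: e N < d, hence e^2 N < 2 e d. *)
pose e := d / (d + N).
have eN : e * (d + N) = d by rewrite divfK// gt_eqF.
have e0 : 0 < e by rewrite divr_gt0.
have e1 : e <= 1 by rewrite ler_pdivrMr// mul1r lerDl.
have := minp _ (convex_setP cD Dp Dq (ltW e0) e1).
rewrite ler_enorm opprD addrA.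
have -> : dotv (x - p - e *: (q - p)) (x - p - e *: (q - p)) =
    dotv (x - p) (x - p) - 2 * e * d + e ^+ 2 * N.
  rewrite /d /N; move: (x - p) (q - p) => u v.
  by rewrite !dotv_lin (dotvC v u); ring.
nra.
Qed.

(** With p and q the projections of x and y, the two variational inequalities add up to |q - p|^2 <=
    <y - x, q - p>; expanding |(y - x) - (q - p)|^2 >= 0 then gives the bound. *)
Lemma proj_nonexpansive D x y : closed D -> convex_set D -> D !=set0 ->
  dotv (proj D y - proj D x) (proj D y - proj D x) <= dotv (y - x) (y - x).
Proof.
move=> clD cD D0.
have [[Dp _] [Dq _]] := (proj_nearest x clD D0, proj_nearest y clD D0).
have hx := proj_variational x clD cD Dq.
have hy := proj_variational y clD cD Dp.
move: (proj D x) (proj D y) hx hy {Dp Dq} => p q hx hy.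
have := dotv_ge0 ((y - x) - (q - p)).
move: hx hy; rewrite !dotv_lin !(dotvC q) !(dotvC p) !(dotvC y); lra.
Qed.

(** The point of the segment from z to c + (k + 1) v with parameter 1 / (k + 1) is z + v + (c - z) /
    (k + 1), which tends to z + v. *)
Lemma translate_closed_convex D c v z : closed D -> convex_set D ->
  (forall k : nat, D (c + k%:R *: v)) -> D z -> D (z + v).
Proof.
move=> clD cD Dcv Dz.
pose u (k : nat) := z + v + harmonic k *: (c - z).
apply: (@closed_cvg _ _ \oo _ u D) => //; last first.
  rewrite -[X in _ --> X]addr0 -[X in _ + X](scale0r (c - z)).
  apply: cvgD; first exact: cvg_cst.
  apply: cvgZr_tmp; exact: cvg_harmonic.
apply: nearW => k.
have := convex_setP cD Dz (Dcv k.+1) (harmonic_ge0 k) _.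
rewrite /u /= invf_le1 ?ltr0n// ler1n => /(_ isT); congr D.
rewrite (addrAC c) (scalerDr _ (c - z)) scalerA mulVf ?pnatr_eq0// scale1r.
by rewrite addrA addrAC.
Qed.

End Euclidean.

(** * Meet and join as translated projections onto the cone *)

Section ConeOperations.
Variables (R : realType) (n : nat).
Implicit Types (z p w : 'rV[R]_n) (K : set 'rV[R]_n).

(** The hypotheses say that p is the projection of w onto K, and projection commutes with
    translation. *)
Lemma cone_joinE K z p w :
  K p -> (forall k, K k -> dotv (w - p) (k - p) <= 0) ->
  cone_join K z (z + w) = z + p.
Proof.
move=> Kp vip; apply: proj_eq; first by exists p.
have addKB a b : z + a - (z + b) = a - b by rewrite opprD addrACA subrr add0r.
by move=> _ [k Kk <-]; rewrite !addKB; exact: vip.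
Qed.

Lemma cone_meetE K z p w :
  K p -> (forall k, K k -> dotv (w - p) (k - p) <= 0) ->
  cone_meet K z (z - w) = z - p.
Proof.
move=> Kp vip; apply: proj_eq; first by exists p.
have subKB a b : z - a - (z - b) = - (a - b).
  by rewrite !opprD addrACA subrr add0r.
by move=> _ [k Kk <-]; rewrite !subKB dotvNl dotvNr opprK; exact: vip.
Qed.

End ConeOperations.

(** * Projection onto the Lorentz cone *)

Section Lorentz.
Variables (R : realType) (m : nat).
Implicit Types (x y u v q w : 'rV[R]_m) (z : 'rV[R]_(m + 1)) (s t l : R).
Implicit Types (M : set 'rV[R]_(m + 1)).

Local Notation K := (@lorentz_cone R m).
Local Notation pt x t := (row_mx x (const_mx t : 'rV[R]_1)).

Lemma ptE z : z = pt (lsubmx z) (rsubmx z 0 0).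
Proof.
rewrite -[LHS]hsubmxK; congr row_mx.
by apply/rowP => i; rewrite !mxE (ord1 i).
Qed.

Lemma ptD x y s t : pt x s + pt y t = pt (x + y) (s + t).
Proof. by rewrite add_row_mx; congr row_mx; apply/rowP => i; rewrite !mxE. Qed.

Lemma ptN x t : - pt x t = pt (- x) (- t).
Proof. by rewrite opp_row_mx; congr row_mx; apply/rowP => i; rewrite !mxE. Qed.

Lemma ptZ l x t : l *: pt x t = pt (l *: x) (l * t).
Proof. by rewrite scale_row_mx; congr row_mx; apply/rowP => i; rewrite !mxE. Qed.

Lemma dotv_pt x y s t : dotv (pt x s) (pt y t) = dotv x y + s * t.
Proof.
by rewrite /dotv tr_row_mx mul_row_col mxE [X in _ + X]mxE big_ord1 !mxE.
Qed.

Lemma lorentz_pt x t : K (pt x t) = (enorm x <= t) :> Prop.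
Proof. by rewrite /lorentz_cone /mkset row_mxKl row_mxKr mxE. Qed.

(* Between the cone and its opposite, |t| <= |x|, so t = (2 l - 1) |x|. *)
Lemma lorentz_variational_mid x l : 0 <= l -> l <= 1 ->
  let p := pt (l *: x) (l * enorm x) in
  K p /\ forall k, K k ->
    dotv (pt x ((2 * l - 1) * enorm x) - p) (k - p) <= 0.
Proof.
move=> l0 l1 p; split.
  rewrite lorentz_pt -ler_sqr ?nnegrE ?enorm_ge0 ?mulr_ge0 ?enorm_ge0//.
  by rewrite exprMn !enorm_sqr !dotv_lin; lra.
move=> k; rewrite (ptE k) lorentz_pt /p; move: (lsubmx k) (rsubmx k 0 0) => v s vs.
rewrite !ptN !ptD dotv_pt !dotv_lin.
have := CauchySchwarz_enorm x v.
have := enorm_ge0 x; have := enorm_sqr x.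
move: vs; set a := enorm x; set b := enorm v; set c := dotv x v => vs <- a0 cab.
have cas : c <= a * s by rewrite (le_trans cab)// ler_wpM2l.
(* The residual is (1 - l) (x, -|x|), orthogonal to p, so the scalar product in the goal equals this
   number. *)
have : (1 - l) * (c - a * s) <= 0 by nra.
nra.
Qed.

(* The projection of the Lorentz cone moves the horizontal component along a
   segment to the origin. *)
Lemma lorentz_variational x t : exists l s,
  [/\ 0 <= l, l <= 1, K (pt (l *: x) s) &
   forall k, K k ->
     dotv (pt x t - pt (l *: x) s) (k - pt (l *: x) s) <= 0].
Proof.
have [xt|tx] := leP (enorm x) t.
  exists 1, t; rewrite scale1r lorentz_pt; split=> // k _.
  by rewrite subrr -(scale0r 0) dotvZl mul0r.
(* In the first case (x, t) lies in -K, the polar cone of K, and projects to the origin. *)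
have [xNt|Ntx] := leP (enorm x) (- t).
  exists 0, 0; rewrite scale0r lorentz_pt /enorm -(scale0r 0) dotvZl mul0r sqrtr0.
  split=> // k; rewrite (ptE k) lorentz_pt scale0r.
  move: (lsubmx k) (rsubmx k 0 0) => v s vs.
  rewrite !ptN !ptD !subr0 dotv_pt.
  have := CauchySchwarz_enorm x v; have := enorm_ge0 x; have := enorm_ge0 v; nra.
have x0 : 0 < enorm x by lra.
pose l := (t / enorm x + 1) / 2.
have tE : t = (2 * l - 1) * enorm x by rewrite /l; field; rewrite gt_eqF.
have [||Kp vip] := @lorentz_variational_mid x l; [nra|nra|].
by exists l, (l * enorm x); rewrite tE; split=> //; nra.
Qed.

End Lorentz.

(** * Invariant sets, vertical lines and cylinders *)

Section Cylinder.
Variables (R : realType) (m : nat).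
Implicit Types (x y u v q w : 'rV[R]_m) (z c : 'rV[R]_(m + 1)) (s t l : R).
Implicit Types (M : set 'rV[R]_(m + 1)).

Local Notation K := (@lorentz_cone R m).
Local Notation pt x t := (row_mx x (const_mx t : 'rV[R]_1)).

(** The column q^T has rank at most 1 < m, so some nonzero row vector annihilates it; rescaling
    gives norm t. *)
Lemma exists_orthogonal q t : (1 < m)%N -> 0 <= t ->
  exists w, dotv q w = 0 /\ enorm w = t.
Proof.
move=> m1 t0.
have /rowV0Pn[w] : kermx q^T != 0.
  rewrite kermx_eq0 /row_free; apply: contraTneq m1 => <-.
  by rewrite -leqNgt rank_leq_col.
move=> /sub_kermxP wq w0.
have ww : 0 < dotv w w.
  rewrite lt_def dotv_ge0 andbT; apply: contra_neq w0 => ww.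
  by apply: dotv0_eq0; rewrite ww.
exists ((t / enorm w) *: w); split.
  by rewrite dotvZr dotvC /dotv wq mxE mulr0.
rewrite /enorm !dotv_lin mulrA -expr2 exprMn exprVn enorm_sqr divfK ?gt_eqF//.
by rewrite sqrtr_sqr ger0_norm.
Qed.

(* For w orthogonal to q with |w| = t / (k + 1), the join of the two points of
   the k-th ellipsoid over q - w and q + w at height k t / (k + 1) lies over q
   at height t.  The meet handles t < 0. *)
Lemma ellipsoid_sub M c (r : R) (k : nat) q t : (1 < m)%N ->
  cone_invariant K M ->
  (forall q, dotv q q <= r -> M (c + pt q 0)) ->
  dotv q q <= r -> t ^+ 2 <= k%:R * (r - dotv q q) -> M (c + pt q t).
Proof.
move=> m1 invM disc; elim: k q t => [|k IHk] q t qr tk.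
  have -> : t = 0 by apply/eqP; rewrite -sqrf_eq0; nra.
  exact: disc.
have k0 : 0 < k.+1%:R :> R by rewrite ltr0n.
pose h := t / k.+1%:R.
have tE : t = (k%:R + 1) * h.
  by rewrite /h mulrC natr1 divfK// gt_eqF.
have [w [qw wh]] := exists_orthogonal q m1 (normr_ge0 h).
have ww : dotv w w = h ^+ 2 by rewrite -enorm_sqr wh real_normK ?num_real.
have hk : (k%:R + 1) * h ^+ 2 <= r - dotv q q.
  by rewrite -(ler_pM2l k0); move: tk; rewrite tE -natr1; lra.
have kp : 0 <= k%:R :> R by [].
(* As |q + e w|^2 = |q|^2 + h^2, membership in the k-th ellipsoid amounts to k^2 h^2 <= k (r - |q|^2
   - h^2), which follows from [hk]. *)
have Mqw (e : R) : e ^+ 2 = 1 -> M (c + pt (q + e *: w) (k%:R * h)).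
  move=> e1.
  have qwE : dotv (q + e *: w) (q + e *: w) = dotv q q + h ^+ 2.
    by rewrite !dotv_lin (dotvC w) qw ww; ring: e1.
  by apply: IHk; rewrite qwE; nra.
have Mu : M (c + pt (q - w) (k%:R * h)).
  by have := Mqw (-1); rewrite scaleN1r sqrrN expr1n; exact.
have Mv : M (c + pt (q + w) (k%:R * h)).
  by have := Mqw 1; rewrite scale1r expr1n; exact.
(* The two points differ by (2 w, 0), whose projection onto K is (w, |h|), the case l = 1/2. *)
have [||] := @lorentz_variational_mid R m (2 *: w) 2^-1; [lra|lra|].
have -> : enorm (2 *: w) = 2 * `|h|.
  rewrite -wh /enorm !dotv_lin mulrA -expr2 sqrtrM ?sqr_ge0//.
  by rewrite sqrtr_sqr ger0_norm.
rewrite divff// subrr mul0r scalerA mulVf// scale1r mulKf// => Kp vip.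
have uvE :
    c + pt (q - w) (k%:R * h) + pt (2 *: w) 0 = c + pt (q + w) (k%:R * h).
  by rewrite -addrA ptD addr0 scaler_nat mulr2n addrA subrK.
have [h0|h0] := leP 0 h.
  have := (invM _ _ Mu Mv).2; rewrite -uvE (cone_joinE _ Kp vip) -addrA ptD subrK.
  by rewrite ger0_norm// tE mulrDl mul1r.
have := (invM _ _ Mv Mu).1.
have -> :
    c + pt (q - w) (k%:R * h) = c + pt (q + w) (k%:R * h) - pt (2 *: w) 0.
  by rewrite -uvE addrK.
rewrite (cone_meetE _ Kp vip) ptN -addrA ptD addrK.
by rewrite ltr0_norm// opprK tE mulrDl mul1r.
Qed.

Lemma invariant_vertical M z t : (1 < m)%N -> closed M -> convex_set M ->
  interior M !=set0 -> cone_invariant K M -> M z -> M (z + pt 0 t).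
Proof.
move=> m1 clM cM [c /nbhs_ballP[r /= r0 ballM]] invM Mz.
(* This is a squared radius, as [ellipsoid_sub] expects; halving r fits the closed Euclidean disc
   into the open sup-norm ball. *)
pose e := (r / 2) ^+ 2.
have disc q : dotv q q <= e -> M (c + pt q 0).
  move=> qe; apply: ballM; rewrite -ball_normE /= opprD addrA subrr add0r normrN.
  rewrite (le_lt_trans (norm_le_enorm _))// /enorm dotv_pt mulr0 addr0.
  rewrite (le_lt_trans (y := r / 2))//; last by lra.
  have r2 : 0 <= r / 2 by rewrite ltW// divr_gt0.
  by rewrite -(ger0_norm r2) -sqrtr_sqr ler_sqrt// sqr_ge0.
apply: (@translate_closed_convex _ _ M c) => // k.
have e0 : 0 < e by rewrite exprn_gt0// divr_gt0.
(* The N-th ellipsoid is tall enough to contain the point at height k t above c. *)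
pose N := Num.bound ((k%:R * t) ^+ 2 / e).
have Nlt : (k%:R * t) ^+ 2 <= N%:R * e.
  by rewrite -ler_pdivrMr// ltW// archi_boundP// divr_ge0 ?sqr_ge0// ltW.
rewrite ptZ scaler0; apply: (@ellipsoid_sub M c e N) => //.
  by rewrite -(scale0r 0) dotvZl mul0r ltW.
by rewrite -(scale0r 0) dotvZl mul0r subr0.
Qed.

(** The join of z and z' is z plus the projection of z' - z onto K, and the meet is z minus the
    projection of z - z'. Either way the horizontal part lies on the segment between those of z and
    z'. *)
Lemma cylinder_invariant (C : set 'rV[R]_m) :
  convex_set C -> cone_invariant K (cylinder C).
Proof.
move=> cC z z' Cz Cz'.
have seg l : 0 <= l -> l <= 1 -> C (lsubmx z + l *: (lsubmx z' - lsubmx z)).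
  by move=> l0 l1; exact: convex_setP.
split.
  have := ptE (z - z'); set w := lsubmx _; set s := rsubmx _ _ _ => wE.
  have -> : z' = z - pt w s by rewrite -wE subKr.
  have [l [s' [l0 l1 Kp vip]]] := lorentz_variational w s.
  rewrite (cone_meetE _ Kp vip) /cylinder /mkset !raddfB /= row_mxKl.
  by have := seg l l0 l1; rewrite -opprB scalerN -raddfB.
have := ptE (z' - z); set w := lsubmx _; set s := rsubmx _ _ _ => wE.
have -> : z' = z + pt w s by rewrite -wE addrC subrK.
have [l [s' [l0 l1 Kp vip]]] := lorentz_variational w s.
rewrite (cone_joinE _ Kp vip) /cylinder /mkset !raddfD /= row_mxKl.
by have := seg l l0 l1; rewrite -raddfB.
Qed.

(** Adding to the projection the vertical part of the residual stays in M; tested there, the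
    variational inequality says that the square of this part is at most 0. *)
Lemma proj_vertical_invariant M z :
  closed M -> convex_set M -> M !=set0 ->
  (forall z' t, M z' -> M (z' + pt 0 t)) ->
  rsubmx (proj M z) = rsubmx z.
Proof.
move=> clM cM M0 vertM.
have [Mp _] := proj_nearest z clM M0.
have := proj_variational z clM cM (vertM _ (rsubmx (z - proj M z) 0 0) Mp).
set d := z - _; rewrite addrAC subrr add0r [d in dotv d _]ptE dotv_pt.
rewrite -(scale0r 0) dotvZr mul0r add0r -expr2 => d0.
apply/esym/eqP; rewrite -subr_eq0 -raddfB -/d; apply/eqP/matrixP => i j.
rewrite !ord1 [RHS]mxE; apply/eqP; rewrite -sqrf_eq0.
by rewrite eq_le d0 sqr_ge0.
Qed.

(** Projection preserves height differences, so nonexpansiveness bounds the horizontal difference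
    alone and the cone inequality is inherited. *)
Lemma vertical_invariant_isotone M :
  closed M -> convex_set M -> M !=set0 ->
  (forall z' t, M z' -> M (z' + pt 0 t)) ->
  isotone_projection_set K M.
Proof.
move=> clM cM M0 vertM z z'; rewrite /cone_le /lorentz_cone /mkset.
have rE : rsubmx (proj M z' - proj M z) = rsubmx (z' - z).
  by rewrite !raddfB /= !(proj_vertical_invariant _ clM cM M0 vertM).
rewrite rE => /(le_trans _); apply.
have := proj_nonexpansive z z' clM cM M0.
rewrite ler_enorm (ptE (proj M z' - _)) (ptE (z' - z)) !dotv_pt !row_mxKl rE.
by rewrite lerD2r.
Qed.

Lemma ball_pt x y t (e : R) : ball x e y -> ball (pt x t) e (pt y t).
Proof.
case=> e0 xy; split=> // i j; rewrite mxE [X in ball _ _ X]mxE.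
by case: (fintype.split j) => k; [exact: xy|exact: ballxx].
Qed.

Lemma continuous_pt t : continuous (fun x => pt x t : 'rV[R]_(m + 1)).
Proof.
move=> x A /= /nbhs_ballP[e e0 eA].
by apply/nbhs_ballP; exists e => // y xy; exact/eA/ball_pt.
Qed.

Lemma vertical_invariant_cylinder M :
  closed M -> convex_set M -> interior M !=set0 ->
  (forall z' t, M z' -> M (z' + pt 0 t)) ->
  exists C : set 'rV[R]_m,
    [/\ closed C, convex_set C, interior C !=set0 & M = cylinder C].
Proof.
move=> clM cM [c /nbhs_ballP[r /= r0 ballM]] vertM.
have vertE x s t : M (pt x s) -> M (pt x t).
  by move=> /(vertM _ (t - s)); rewrite ptD addr0 addrC subrK.
(* The base is the slice at height 0; by [vertE] all horizontal slices agree. *)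
exists [set x | M (pt x 0)]; split.
- apply: (@preimage_closed _ _ (fun x => pt x 0) M) => // x _.
  exact: continuous_pt.
- move=> x y l; rewrite !inE /= => Mx My.
  have := cM (pt x 0) (pt y 0) l; rewrite !inE => /(_ Mx My); congr M.
  by rewrite [LHS]/conv /= !ptZ ptD !mulr0 addr0.
(* The ball about c is cut at the height of c, and the slice is then moved to height 0. *)
- exists (lsubmx c); apply/nbhs_ballP; exists r => //= x xr.
  apply: (@vertE _ (rsubmx c 0 0)); apply: ballM.
  by rewrite {1}(ptE c); exact: ball_pt.
- apply/seteqP; split=> z; rewrite /cylinder /mkset.
    by rewrite {1}(ptE z); exact: vertE.
  by rewrite [X in _ -> M X]ptE; exact: vertE.
Qed.

End Cylinder.

Theorem corollary3 (R : realType) (m : nat) (M : set 'rV[R]_(m + 1)) :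
  (1 < m)%N ->
  closed M -> convex_set M -> interior M !=set0 ->
  ((exists C : set 'rV[R]_m,
      [/\ closed C, convex_set C, interior C !=set0 & M = cylinder C])
    <-> cone_invariant (@lorentz_cone R m) M) /\
  (cone_invariant (@lorentz_cone R m) M ->
    isotone_projection_set (@lorentz_cone R m) M).
Proof.
move=> m1 clM cM M0.
have vertM invM z t := @invariant_vertical R m M z t m1 clM cM M0 invM.
split; first split.
- by move=> [C [_ cC _ ->]]; exact: cylinder_invariant.
- by move=> invM; apply: vertical_invariant_cylinder => // z t; exact: vertM.
- move=> invM; apply: vertical_invariant_isotone => //.
    by have [c /interior_subset Mc] := M0; exists c.
  by move=> z t; exact: vertM.
Qed.
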